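(* Consider the harmonic oscillator $\dot x=y$, $\dot y=-x$, i.e. the vector field $F(x,y)=(y,-x)$ on $\mathbb{R}^2$. Given the conservation law $$H\big((\dot x,\dot y),(x,y)\big)=\tfrac12(x\dot x+y\dot y)^2+\tfrac12(\dot x^2+\dot y^2-x^2-y^2)^2,$$ the system is discoverable in the space of analytic vector fields from any single trajectory away from the origin. That is: for every non-zero solution $u$ of $\dot u=F(u)$, $F$ is the only real analytic $G:\mathbb{R}^2\to\mathbb{R}^2$ such that $\dot u=G(u)$ and $\nabla_vH(G(w),w)=0$ for all $w\in\mathbb{R}^2$.
   Context: $H(v,u)$ is regarded as a function of $v=(\dot x,\dot y)\in\mathbb{R}^2$ and $u=(x,y)\in\mathbb{R}^2$, and $\nabla_v$ is the gradient in the first vector argument $v$. Discoverable ''given the conservation law $H$'' means uniqueness among analytic vector fields $G$ that reproduce the trajectory and satisfy $\nabla_vH(G(w),w)=0$ for all $w$. *)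

(* Defs.v *)
From Stdlib Require Import Reals.
From Coquelicot Require Import Coquelicot.
Open Scope R_scope.

Definition dbl_sum (s : nat -> nat -> R) (N : nat) : R :=
  sum_n (fun i => sum_n (fun j => s i j) N) N.

(* For an absolutely summable double series, the sum is independent of the
   order of summation, so it is the limit of the square partial sums; absolute
   summability is convergence of the square partial sums of absolute values. *)
Definition is_abs_dbl_series (s : nat -> nat -> R) (l : R) : Prop :=
  ex_finite_lim_seq (dbl_sum (fun i j => Rabs (s i j))) /\
  is_lim_seq (dbl_sum s) l.

Definition real_analytic (f : R * R -> R) : Prop :=
  forall p : R * R, exists (c : nat -> nat -> R) (r : R), 0 < r /\
    forall x y : R, Rabs (x - fst p) < r -> Rabs (y - snd p) < r ->
      is_abs_dbl_series
        (fun i j => c i j * (x - fst p) ^ i * (y - snd p) ^ j) (f (x, y)).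

Definition analytic_field (G : R * R -> R * R) : Prop :=
  real_analytic (fun w => fst (G w)) /\ real_analytic (fun w => snd (G w)).

Definition is_gradient (f : R * R -> R) (v g : R * R) : Prop :=
  filterdiff f (locally v) (fun h => fst g * fst h + snd g * snd h).

(* The time domain is the open interval ]a, b[, possibly unbounded. *)
Definition is_solution (G : R * R -> R * R) (a b : Rbar) (u : R -> R * R) :
    Prop :=
  forall t : R, Rbar_lt a t -> Rbar_lt t b -> is_derive u t (G (u t)).

Definition nonzero_on (a b : Rbar) (u : R -> R * R) : Prop :=
  exists t : R, Rbar_lt a t /\ Rbar_lt t b /\ u t <> (0, 0).

Definition gradient_condition (H : R * R -> R * R -> R)
    (G : R * R -> R * R) : Prop :=
  forall w : R * R, is_gradient (fun v => H v w) (G w) (0, 0).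

Definition discoverable_given (H : R * R -> R * R -> R)
    (F : R * R -> R * R) (a b : Rbar) (u : R -> R * R) : Prop :=
  unique (fun G => analytic_field G /\ is_solution G a b u /\
                   gradient_condition H G) F.

Definition oscillator (w : R * R) : R * R := (snd w, - fst w).

Definition oscillator_law (v u : R * R) : R :=
  / 2 * (fst u * fst v + snd u * snd v) ^ 2 +
  / 2 * (fst v ^ 2 + snd v ^ 2 - fst u ^ 2 - snd u ^ 2) ^ 2.

(* Main.v *)
Require Import Defs.
From Stdlib Require Import Reals Lra Lia FunctionalExtensionality.
From Coquelicot Require Import Coquelicot.
Open Scope R_scope.

(** Write [J w = oscillator w] for the rotation [(x, y) |-> (y, -x)].  For a fixed
    position [w] the gradient of the law in the velocity [v] is
    [(w . v) w + 2 c v] with [c = |v|^2 - |w|^2].  If [w <> 0] it vanishes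
    exactly at [v = 0], [v = w / sqrt 2], [v = - w / sqrt 2], [v = J w] and
    [v = - J w]; if [w = 0] only at [v = 0], which is [J 0].
    So the gradient condition alone confines an admissible field [G] to
    finitely many branches, and [v . J w] tells the branch [J w] apart from the
    others: it is [|w|^2] there and at most [0] elsewhere
    ([oscillator_law_critical]).

    An analytic field is continuous ([real_analytic_continuous]), so by the
    intermediate value theorem [G] cannot change branch along a segment that
    avoids the origin ([oscillator_along_segment]).  Any two non-zero points
    are joined by at most two such segments, so agreement with [J] at one
    non-zero point is agreement everywhere ([gradient_condition_rigid]).  The
    trajectory supplies such a point: at any time when it is non-zero, both [G]
    and [J] give its derivative. *)

(** * Absolutely summable double power series *)

Lemma sum_n_dist_le (a b d : nat -> R) (eps : R) (N : nat) :
  (forall i, Rabs (a i - b i) <= eps * d i) ->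
  Rabs (sum_n a N - sum_n b N) <= eps * sum_n d N.
Proof.
  intros H; induction N as [|N IH].
  - rewrite !sum_O; apply H.
  - rewrite !sum_Sn; unfold plus; simpl.
    replace (sum_n a N + a (S N) - (sum_n b N + b (S N)))
      with ((sum_n a N - sum_n b N) + (a (S N) - b (S N))) by ring.
    eapply Rle_trans; [apply Rabs_triang|].
    specialize (H (S N)); lra.
Qed.

Lemma dbl_sum_dist_le (s s' d : nat -> nat -> R) (eps : R) (N : nat) :
  (forall i j, Rabs (s i j - s' i j) <= eps * d i j) ->
  Rabs (dbl_sum s N - dbl_sum s' N) <= eps * dbl_sum d N.
Proof.
  intros H; apply sum_n_dist_le; intros i; apply sum_n_dist_le; auto.
Qed.

Lemma sum_n_first_two (a : nat -> R) (N : nat) :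
  (forall n, a (S (S n)) = 0) -> sum_n a (S N) = a 0%nat + a 1%nat.
Proof.
  intros H; induction N as [|N IH].
  - now rewrite sum_Sn, sum_O.
  - rewrite sum_Sn, IH, H; unfold plus; simpl; ring.
Qed.

(** Makes explicit the partial sums of the Taylor series of a linear form. *)
Lemma dbl_sum_bilinear (s : nat -> nat -> R) (N : nat) :
  (forall i j, s (S (S i)) j = 0) -> (forall i j, s i (S (S j)) = 0) ->
  dbl_sum s (S N) =
    s 0%nat 0%nat + s 0%nat 1%nat + (s 1%nat 0%nat + s 1%nat 1%nat).
Proof.
  intros H1 H2; unfold dbl_sum.
  rewrite sum_n_first_two.
  - now rewrite !sum_n_first_two by auto.
  - intros n; rewrite sum_n_first_two by auto; rewrite !H1; ring.
Qed.

Lemma is_lim_seq_eventually_const (a : nat -> R) (l : R) :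
  (forall n, a (S n) = l) -> is_lim_seq a l.
Proof.
  intros H; apply is_lim_seq_incr_1.
  apply is_lim_seq_ext with (fun _ => l); [now intros n; rewrite H|].
  apply is_lim_seq_const.
Qed.

(** The Taylor expansion at any point is the linear form itself, so its partial
    sums are stationary from rank 1 on. *)
Lemma real_analytic_linear (a b : R) :
  real_analytic (fun w => a * fst w + b * snd w).
Proof.
  intros [p q]; simpl.
  exists (fun i j => match i, j with
     | 0%nat, 0%nat => a * p + b * q
     | 1%nat, 0%nat => a
     | 0%nat, 1%nat => b
     | _, _ => 0 end).
  exists 1; split; [lra|].
  intros x y _ _; split.
  - eexists; apply is_lim_seq_eventually_const; intros n.
    rewrite dbl_sum_bilinear; [reflexivity| |].
    + intros i j; rewrite !Rmult_0_l; apply Rabs_R0.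
    + intros [|[|i]] j; rewrite !Rmult_0_l; apply Rabs_R0.
  - apply is_lim_seq_eventually_const; intros n.
    rewrite dbl_sum_bilinear.
    + simpl; ring.
    + intros i j; ring.
    + intros [|[|i]] j; ring.
Qed.

(** Every non-constant monomial carries at least one factor that is at most
    [eps * rho] in absolute value, and the constant one cancels in the
    difference; hence the whole series varies by at most [eps] times its sum of
    absolute values at radius [rho]. *)
Lemma monomial_dist_le (c h k rho eps : R) (i j : nat) :
  0 <= eps <= 1 -> 0 < rho ->
  Rabs h <= eps * rho -> Rabs k <= eps * rho ->
  Rabs (c * h ^ i * k ^ j - c * 0 ^ i * 0 ^ j)
    <= eps * Rabs (c * rho ^ i * rho ^ j).
Proof.
  intros He Hr Hh Hk.
  assert (P : forall z n, Rabs z <= eps * rho ->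
                Rabs (z ^ n) <= rho ^ n /\ Rabs (z ^ S n) <= eps * rho ^ S n).
  { intros z n Hz.
    assert (Hn : Rabs (z ^ n) <= rho ^ n).
    { rewrite <- RPow_abs; apply pow_incr; split; [apply Rabs_pos|nra]. }
    split; [exact Hn|].
    simpl; rewrite Rabs_mult, <- Rmult_assoc.
    apply Rmult_le_compat; auto using Rabs_pos. }
  assert (Q : forall n, 0 <= rho ^ n) by (intros n; apply pow_le; lra).
  rewrite !Rabs_mult, !(Rabs_pos_eq (rho ^ _)) by apply Q.
  destruct i as [|i]; [destruct j as [|j]|].
  - simpl; rewrite Rminus_diag, Rabs_R0, !Rmult_1_r.
    apply Rmult_le_pos; [lra|apply Rabs_pos].
  - rewrite (pow_i (S j)) by lia.
    rewrite Rmult_0_r, Rminus_0_r, !pow_O, !Rmult_1_r, Rabs_mult.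
    destruct (P k j Hk) as [_ H]; pose proof (Rabs_pos c); nra.
  - rewrite (pow_i (S i)) by lia.
    rewrite Rmult_0_r, Rmult_0_l, Rminus_0_r, !Rabs_mult.
    destruct (P h i Hh) as [_ H].
    assert (Hkj : Rabs (k ^ j) <= rho ^ j) by (apply (P k j Hk)).
    replace (eps * (Rabs c * rho ^ S i * rho ^ j))
      with (Rabs c * (eps * rho ^ S i) * rho ^ j) by ring.
    apply Rmult_le_compat; auto using Rabs_pos.
    + apply Rmult_le_pos; apply Rabs_pos.
    + apply Rmult_le_compat_l; auto using Rabs_pos.
Qed.

(** [M] is the sum of the absolute values of the terms at the corner
    [p + (rho, rho)], which still lies in the domain of expansion.  Comparing
    the series at [(x, y)] with the same series evaluated at [p], rather than
    with its constant coefficient, allows a termwise estimate. *)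
Lemma real_analytic_lipschitz (f : R * R -> R) (p : R * R) :
  real_analytic f ->
  exists M rho : R, 0 < rho /\
    forall (eps x y : R), 0 <= eps <= 1 ->
      Rabs (x - fst p) <= eps * rho -> Rabs (y - snd p) <= eps * rho ->
      Rabs (f (x, y) - f p) <= eps * M.
Proof.
  intros Hf; destruct (Hf p) as (c & r & Hr & Hs).
  assert (HR : Rabs (r / 2) < r) by (rewrite Rabs_pos_eq; lra).
  destruct (Hs (fst p + r / 2) (snd p + r / 2)) as [[M HM] _];
    [now replace (fst p + r / 2 - fst p) with (r / 2) by ring
    |now replace (snd p + r / 2 - snd p) with (r / 2) by ring|].
  destruct (Hs (fst p) (snd p)) as [_ Hp];
    [rewrite Rminus_diag, Rabs_R0; lra ..|].
  rewrite <- surjective_pairing in Hp.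
  exists M, (r / 2); split; [lra|].
  intros eps x y He Hx Hy.
  destruct (Hs x y) as [_ Hxy]; [nra ..|].
  assert (HD := is_lim_seq_abs _ _ (is_lim_seq_minus' _ _ _ _ Hxy Hp)).
  assert (HE := is_lim_seq_scal_l _ eps _ HM).
  refine (is_lim_seq_le _ _ (Finite _) (Finite (eps * M)) _ HD HE).
  intros n; apply dbl_sum_dist_le; intros i j.
  rewrite !Rminus_diag.
  replace (fst p + r / 2 - fst p) with (r / 2) by ring.
  replace (snd p + r / 2 - snd p) with (r / 2) by ring.
  apply monomial_dist_le; auto; lra.
Qed.

Lemma real_analytic_continuous (f : R * R -> R) (p : R * R) :
  real_analytic f -> continuous f p.
Proof.
  intros Hf; destruct (real_analytic_lipschitz f p Hf) as (M & rho & Hr & H).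
  apply filterlim_locally; intros [e He]; simpl.
  set (eps := Rmin 1 (e / (2 * (Rabs M + 1)))).
  assert (HM := Rabs_pos M).
  assert (Hq : 0 < e / (2 * (Rabs M + 1))) by (apply Rdiv_lt_0_compat; lra).
  assert (Heps : 0 < eps <= 1).
  { split; [apply Rmin_pos; lra|apply Rmin_l]. }
  assert (Hd : 0 < eps * rho) by nra.
  exists (mkposreal _ Hd); intros [x y] [Bx By].
  change (Rabs (x - fst p) < eps * rho) in Bx.
  change (Rabs (y - snd p) < eps * rho) in By.
  change (Rabs (f (x, y) - f p) < e).
  apply Rle_lt_trans with (eps * M); [apply H; lra|].
  assert (E : eps <= e / (2 * (Rabs M + 1))) by apply Rmin_r.
  assert (E2 : e / (2 * (Rabs M + 1)) * (Rabs M + 1) = e / 2)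
    by (field; lra).
  pose proof (Rle_abs M); nra.
Qed.

(** * Critical velocities of the conservation law *)

(** Reading off partial derivatives turns a vanishing gradient into two scalar
    equations on the velocity. *)
Lemma is_gradient_Derive (f : R * R -> R) (v g : R * R) :
  is_gradient f v g ->
  Derive (fun z => f (z, snd v)) (fst v) = fst g /\
  Derive (fun z => f (fst v, z)) (snd v) = snd g.
Proof.
  intros H; destruct v as [p q]; simpl.
  apply (differentiable_pt_lim_unique (fun x y => f (x, y))).
  apply filterdiff_differentiable_pt_lim.
  apply filterdiff_ext with f; [now intros []|].
  apply filterdiff_ext_lin with (1 := H).
  intros h; simpl; apply (f_equal2 Rplus); apply Rmult_comm.
Qed.

(** Dispatches on the head operation of a real expression: left to unification,
    the generic ring and module lemmas unfold real arithmetic. *)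
Ltac continuous_poly :=
  cbv beta;
  lazymatch goal with
  | |- continuous (fun _ => ?c) _ => apply continuous_const
  | |- continuous (fun w => @?f w * @?g w) _ =>
      apply (continuous_mult (K := R_AbsRing) f g); continuous_poly
  | |- continuous (fun w => @?f w - @?g w) _ =>
      apply (continuous_minus (V := R_NormedModule) f g); continuous_poly
  | |- continuous (fun w => @?f w + @?g w) _ =>
      apply (continuous_plus (V := R_NormedModule) f g); continuous_poly
  | |- _ => idtac
  end.

Lemma is_derive_oscillator_law_fst (u : R * R) (p q : R) :
  is_derive (fun z => oscillator_law (z, q) u) p
    ((fst u * p + snd u * q) * fst u
     + 2 * (p * p + q * q - fst u ^ 2 - snd u ^ 2) * p).
Proof.
  unfold oscillator_law; simpl; auto_derive; [exact I|field].
Qed.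

Lemma is_derive_oscillator_law_snd (u : R * R) (p q : R) :
  is_derive (fun z => oscillator_law (p, z) u) q
    ((fst u * p + snd u * q) * snd u
     + 2 * (p * p + q * q - fst u ^ 2 - snd u ^ 2) * q).
Proof.
  unfold oscillator_law; simpl; auto_derive; [exact I|field].
Qed.

Lemma is_gradient_oscillator_law (u : R * R) (p q : R) :
  is_gradient (fun v => oscillator_law v u) (p, q)
    ((fst u * p + snd u * q) * fst u
     + 2 * (p * p + q * q - fst u ^ 2 - snd u ^ 2) * p,
     (fst u * p + snd u * q) * snd u
     + 2 * (p * p + q * q - fst u ^ 2 - snd u ^ 2) * q).
Proof.
  apply filterdiff_ext with
    (fun w => (fun x y => oscillator_law (x, y) u) (fst w) (snd w));
    [now intros []|].
  eapply filterdiff_ext_lin.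
  - apply (is_derive_filterdiff (fun x y => oscillator_law (x, y) u) p q
      (fun p q => (fst u * p + snd u * q) * fst u
         + 2 * (p * p + q * q - fst u ^ 2 - snd u ^ 2) * p)).
    + apply filter_forall; intros w; apply is_derive_oscillator_law_fst.
    + apply is_derive_oscillator_law_snd.
    + continuous_poly; first [apply continuous_fst | apply continuous_snd].
  - intros h; unfold plus, scal; simpl; unfold mult; simpl; ring.
Qed.

(** Write [a = u . v], [j = v . J u] and [c = |v|^2 - |u|^2].  The component of
    [a u + 2 c v = 0] along [J u] gives [c j = 0].  So [j > 0] forces [c = 0];
    then [a = 0], and the Lagrange identity [a^2 + j^2 = |u|^2 |v|^2] yields
    [j = |u|^2], the equality case [v = J u].  At [u = 0] the equation reads
    [2 |v|^2 v = 0], and [v = 0 = J u]. *)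
Lemma oscillator_law_critical (v u : R * R) :
  is_gradient (fun v => oscillator_law v u) v (0, 0) ->
  v = oscillator u \/
  (u <> (0, 0) /\ snd u * fst v - fst u * snd v <= 0).
Proof.
  destruct v as [p q]; intros H.
  destruct (is_gradient_Derive _ _ _ H) as [E1 E2].
  apply (eq_trans (eq_sym (is_derive_unique _ _ _
    (is_derive_oscillator_law_fst u p q)))) in E1.
  apply (eq_trans (eq_sym (is_derive_unique _ _ _
    (is_derive_oscillator_law_snd u p q)))) in E2.
  clear H; destruct u as [x y]; unfold oscillator; simpl in *.
  set (a := x * p + y * q) in *.
  set (c := p * p + q * q - x * (x * 1) - y * (y * 1)) in *.
  set (j := y * p - x * q).
  assert (Ha : a = x * p + y * q) by reflexivity.
  assert (Hj : j = y * p - x * q) by reflexivity.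
  assert (Hc : c = p * p + q * q - x * x - y * y) by (unfold c; ring).
  clearbody a c j.
  (* Eliminating the first term of the gradient. *)
  assert (Ecj : c * j = 0).
  { replace (c * j) with
      ((y * (a * x + 2 * c * p) - x * (a * y + 2 * c * q)) / 2)
      by (rewrite Hj; field).
    rewrite E1, E2; field. }
  destruct (Req_dec (x * x + y * y) 0) as [Hu|Hu].
  - left; destruct (Rplus_sqr_eq_0 x y Hu) as [-> ->].
    assert (Hcpq : c = p * p + q * q) by (rewrite Hc; ring).
    assert (Hcc : c * c = 0).
    { rewrite Hcpq at 2.
      replace (c * (p * p + q * q)) with
        ((p * (a * 0 + 2 * c * p) + q * (a * 0 + 2 * c * q)) / 2) by field.
      rewrite E1, E2; field. }
    assert (Hc0 : p * p + q * q = 0)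
      by (rewrite <- Hcpq; apply Rmult_integral in Hcc; lra).
    destruct (Rplus_sqr_eq_0 p q Hc0) as [-> ->].
    f_equal; ring.
  - assert (Hu0 : (x, y) <> (0, 0))
      by (intros E; injection E as -> ->; apply Hu; ring).
    destruct (Rle_or_lt j 0) as [Hj0|Hj0]; [now right|left].
    assert (Hc0 : c = 0) by (apply Rmult_integral in Ecj; lra).
    assert (Ha0 : a = 0).
    { assert (Hau : a * (x * x + y * y) = 0).
      { replace (a * (x * x + y * y)) with
          (x * (a * x + 2 * 0 * p) + y * (a * y + 2 * 0 * q)) by ring.
        rewrite Hc0 in E1, E2; rewrite E1, E2; ring. }
      apply Rmult_integral in Hau; lra. }
    assert (Hn : p * p + q * q = x * x + y * y) by lra.
    assert (Hjn : j = x * x + y * y).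
    { assert (L : (j - (x * x + y * y)) * (j + (x * x + y * y)) = 0).
      { replace ((j - (x * x + y * y)) * (j + (x * x + y * y))) with
          ((p * p + q * q) * (x * x + y * y) - a * a
           - (x * x + y * y) * (x * x + y * y)) by (rewrite Ha, Hj; ring).
        rewrite Hn, Ha0; ring. }
      assert (0 <= x * x + y * y) by nra.
      apply Rmult_integral in L; lra. }
    assert (D : (p - y) * (p - y) + (q + x) * (q + x) = 0).
    { replace ((p - y) * (p - y) + (q + x) * (q + x)) with
        ((p * p + q * q) + (x * x + y * y) - 2 * j) by (rewrite Hj; ring).
      lra. }
    destruct (Rplus_sqr_eq_0 _ _ D).
    f_equal; lra.
Qed.

(** * Propagation from one point to the plane *)

Lemma is_derive_pair_unique (f : R -> R * R) (t : R) (l l' : R * R) :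
  is_derive f t l -> is_derive f t l' -> l = l'.
Proof.
  intros H H'.
  assert (P : forall m : R * R, is_derive f t m ->
    is_derive (fun s => fst (f s)) t (fst m) /\
    is_derive (fun s => snd (f s)) t (snd m)).
  { intros m Hm; split.
    - exact (filterdiff_comp' f fst t _ _ Hm
        (filterdiff_linear _ is_linear_fst)).
    - exact (filterdiff_comp' f snd t _ _ Hm
        (filterdiff_linear _ is_linear_snd)). }
  destruct (P l H) as [A1 A2], (P l' H') as [B1 B2].
  apply injective_projections.
  - rewrite <- (is_derive_unique _ _ _ A1); exact (is_derive_unique _ _ _ B1).
  - rewrite <- (is_derive_unique _ _ _ A2); exact (is_derive_unique _ _ _ B2).
Qed.

(** The angle between [p] and [q] is at most a right angle, so the segment from
    [p] to [q] avoids the origin when [q <> 0].  Along it, [2 (G . J) - |.|^2]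
    is positive on the branch [J] and negative on every other branch; it never
    vanishes, hence keeps its sign. *)
Lemma oscillator_along_segment (G : R * R -> R * R) (p q : R * R) :
  (forall w, continuous (fun w => fst (G w)) w) ->
  (forall w, continuous (fun w => snd (G w)) w) ->
  gradient_condition oscillator_law G ->
  p <> (0, 0) -> 0 <= fst p * fst q + snd p * snd q ->
  G p = oscillator p -> G q = oscillator q.
Proof.
  intros C1 C2 HG Hp Hpq Gp.
  destruct (oscillator_law_critical _ _ (HG q)) as [|[Hq Hj]]; [assumption|].
  exfalso.
  set (X := fun t => fst p + t * (fst q - fst p)).
  set (Y := fun t => snd p + t * (snd q - snd p)).
  set (f := fun t => 2 * (Y t * fst (G (X t, Y t)) - X t * snd (G (X t, Y t)))
                     - (X t * X t + Y t * Y t)).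
  assert (N : forall w : R * R, w <> (0, 0) ->
                0 < fst w * fst w + snd w * snd w).
  { intros [x y] Hw; simpl.
    destruct (Req_dec x 0) as [->|]; [|nra].
    destruct (Req_dec y 0) as [->|]; [now contradiction Hw|nra]. }
  assert (Cf : continuity f).
  { intros t; apply continuity_pt_filterlim.
    change (continuous f t).
    assert (CX : continuous X t).
    { apply (ex_derive_continuous (V := R_NormedModule)); unfold X; auto_derive; exact I. }
    assert (CY : continuous Y t).
    { apply (ex_derive_continuous (V := R_NormedModule)); unfold Y; auto_derive; exact I. }
    assert (CG : forall g : R * R -> R, (forall w, continuous g w) ->
                   continuous (fun s => g (X s, Y s)) t).
    { intros g Cg.
      apply (continuous_comp_2 X Y (fun x y => g (x, y))); auto.
      apply continuous_ext with g; [now intros []|apply Cg]. }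
    unfold f; continuous_poly;
      first [exact CX | exact CY | exact (CG _ C1) | exact (CG _ C2)]. }
  assert (P0 : (X 0, Y 0) = p).
  { unfold X, Y; destruct p; simpl; f_equal; ring. }
  assert (P1 : (X 1, Y 1) = q).
  { unfold X, Y; destruct q; simpl; f_equal; ring. }
  assert (f0 : 0 < f 0).
  { unfold f; rewrite P0, Gp.
    replace (X 0) with (fst p) by now rewrite <- P0.
    replace (Y 0) with (snd p) by now rewrite <- P0.
    pose proof (N p Hp); unfold oscillator; simpl; lra. }
  assert (f1 : f 1 < 0).
  { unfold f; rewrite P1.
    replace (X 1) with (fst q) by now rewrite <- P1.
    replace (Y 1) with (snd q) by now rewrite <- P1.
    pose proof (N q Hq); lra. }
  destruct (IVT_cor f 0 1 Cf) as (z & Hz & fz); [lra|nra|].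
  (* No cancellation: all three terms in the expansion of the square are
     nonnegative. *)
  assert (Nz : 0 < X z * X z + Y z * Y z).
  { pose proof (N p Hp); pose proof (N q Hq).
    assert (E : X z * X z + Y z * Y z =
      (1 - z) * (1 - z) * (fst p * fst p + snd p * snd p)
      + 2 * ((1 - z) * z) * (fst p * fst q + snd p * snd q)
      + z * z * (fst q * fst q + snd q * snd q)) by (unfold X, Y; ring).
    rewrite E.
    assert (0 <= (1 - z) * z * (fst p * fst q + snd p * snd q))
      by (apply Rmult_le_pos; [nra|assumption]).
    destruct (Rle_or_lt z (/ 2)) as [Hz2|Hz2].
    - assert (0 < (1 - z) * (1 - z)) by nra.
      assert (0 <= z * z) by nra.
      nra.
    - assert (0 <= (1 - z) * (1 - z)) by nra.
      assert (0 < z * z) by nra.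
      nra. }
  unfold f in fz.
  destruct (oscillator_law_critical _ _ (HG (X z, Y z))) as [E|[_ E]].
  - rewrite E in fz; unfold oscillator in fz; simpl in fz; lra.
  - simpl in E; lra.
Qed.

(** When [p] and [q] form an obtuse angle, one of the two vectors orthogonal to
    [p] makes an acute or right angle with [q] and serves as a relay. *)
Lemma gradient_condition_rigid (G : R * R -> R * R) (p q : R * R) :
  (forall w, continuous (fun w => fst (G w)) w) ->
  (forall w, continuous (fun w => snd (G w)) w) ->
  gradient_condition oscillator_law G ->
  p <> (0, 0) -> G p = oscillator p -> G q = oscillator q.
Proof.
  intros C1 C2 HG Hp Gp.
  assert (Step := oscillator_along_segment G).
  destruct (Rle_or_lt 0 (fst p * fst q + snd p * snd q)) as [H|H];
    [now apply (Step p)|].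
  set (m := fun s : R => (s * snd p, - (s * fst p))).
  assert (Hm : forall s, s <> 0 ->
    0 <= s * (snd p * fst q - fst p * snd q) -> G q = oscillator q).
  { intros s Hs Hsq; apply (Step (m s)); auto.
    - intros E; apply Hp; unfold m in E; injection E as E1 E2.
      destruct p as [x y]; simpl in *; f_equal; nra.
    - unfold m; simpl; lra.
    - apply (Step p); auto; unfold m; simpl; lra. }
  destruct (Rle_or_lt 0 (snd p * fst q - fst p * snd q)).
  - apply (Hm 1); lra.
  - apply (Hm (-1)); lra.
Qed.

Theorem corollary6p5 (a b : Rbar) (u : R -> R * R)
    (hu : is_solution oscillator a b u) (hu0 : nonzero_on a b u) :
  discoverable_given oscillator_law oscillator a b u.
Proof.
  split; [split; [|split]|].
  - split; unfold oscillator; simpl.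
    + replace (fun w : R * R => snd w) with (fun w : R * R => 0 * fst w + 1 * snd w)
        by (apply functional_extensionality; intros; ring).
      apply real_analytic_linear.
    + replace (fun w : R * R => - fst w) with (fun w : R * R => -1 * fst w + 0 * snd w)
        by (apply functional_extensionality; intros; ring).
      apply real_analytic_linear.
  - exact hu.
  - intros [x y].
    replace (0, 0) with
      ((x * y + y * (- x)) * x + 2 * (y * y + (- x) * (- x) - x ^ 2 - y ^ 2) * y,
       (x * y + y * (- x)) * y
       + 2 * (y * y + (- x) * (- x) - x ^ 2 - y ^ 2) * (- x))
      by (f_equal; ring).
    apply (is_gradient_oscillator_law (x, y)).
  - intros G ([A1 A2] & HGu & HG).
    destruct hu0 as (t & Ha & Hb & Ht).
    apply functional_extensionality; intros w; symmetry.
    apply gradient_condition_rigid with (u t); auto.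
    + intros z; now apply real_analytic_continuous.
    + intros z; now apply real_analytic_continuous.
    + exact (is_derive_pair_unique u t _ _ (HGu t Ha Hb) (hu t Ha Hb)).
Qed.
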